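(* The problem Maximum Matching Cut is solvable in polynomial time on bipartite graphs of radius at most $2$.
   Context: Graphs are finite, simple and undirected. The distance $\mathrm{dist}(u,v)$ is the length of a shortest path from $u$ to $v$; a graph has radius at most $r$ if there is a vertex $v$ such that $\mathrm{dist}(v,u)\le r$ for all vertices $u$ (in particular such a graph is connected). A matching $M\subseteq E(G)$ is a set of pairwise non-adjacent edges. A matching $M$ is a matching cut of $G$ if there is a partition of $V(G)$ into two non-empty sets $A$ and $B$ such that the edges of $M$ are exactly the edges of $G$ with one endvertex in $A$ and one in $B$. The size of a matching cut is its number of edges. The problem Maximum Matching Cut takes a graph $G$ as input and asks for the maximum size of a matching cut of $G$ (or to report that $G$ has no matching cut). *)

(* Defs.v *)
From mathcomp Require Import all_boot.

Set Implicit Arguments.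
Unset Strict Implicit.
Unset Printing Implicit Defensive.

(* Vertices are numbered, so that a graph can be written down as an input. *)
Record graph := Graph {
  order : nat;
  adj : rel 'I_order;
  adj_sym : symmetric adj;
  adj_irrefl : irreflexive adj
}.

Notation vertex G := 'I_(order G).

Definition edges (G : graph) : {set {set vertex G}} :=
  [set [set p.1; p.2] | p : vertex G * vertex G & adj p.1 p.2].

Definition is_path (G : graph) (u v : vertex G) (p : seq (vertex G)) : bool :=
  [&& path (@adj G) u p, uniq (u :: p) & last u p == v].

(* A relation, since the distance is undefined between different components.
   The path is [u :: p], of length [size p]. *)
Definition is_dist (G : graph) (u v : vertex G) (d : nat) : Prop :=
  (exists2 p, is_path u v p & size p = d) /\
  (forall p, is_path u v p -> d <= size p).

Definition radius_at_most (r : nat) (G : graph) : Prop :=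
  exists v : vertex G, forall u : vertex G, exists2 d, is_dist v u d & d <= r.

Definition bipartition (G : graph) (A B : {set vertex G}) : Prop :=
  A :|: B = [set: vertex G] /\ [disjoint A & B].

Definition independent (G : graph) (A : {set vertex G}) : Prop :=
  {in A &, forall x y, ~~ adj x y}.

Definition bipartite (G : graph) : Prop :=
  exists A B : {set vertex G},
    [/\ bipartition A B, independent A & independent B].

Definition matching (G : graph) (M : {set {set vertex G}}) : Prop :=
  M \subset edges G /\ trivIset M.

Definition cut_edges (G : graph) (A B : {set vertex G}) : {set {set vertex G}} :=
  [set [set x; y] | x in A, y in B & adj x y].

Definition matching_cut (G : graph) (M : {set {set vertex G}}) : Prop :=
  matching M /\
  exists A B : {set vertex G},
    [/\ bipartition A B, A != set0, B != set0 & M = cut_edges A B].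

(* [None] reports that there is no matching cut. *)
Definition maximum_matching_cut (G : graph) (answer : option nat) : Prop :=
  match answer with
  | Some k => (exists2 M : {set {set vertex G}}, matching_cut M & #|M| = k) /\
              (forall M : {set {set vertex G}}, matching_cut M -> #|M| <= k)
  | None => forall M : {set {set vertex G}}, ~ matching_cut M
  end.

(* The random access machine of Cook and Reckhow, with natural numbers in the
   registers.  The arithmetic is restricted to addition and (truncated)
   subtraction, so that in [t] steps registers and addresses stay below
   [c * 2 ^ t] for a constant [c] of the program; hence the number of executed
   instructions is polynomially related to the running time of a Turing
   machine. *)

Inductive instr :=
  | Const of nat & nat          (* X_i <- c *)
  | Add of nat & nat & nat      (* X_i <- X_j + X_k *)
  | Sub of nat & nat & nat      (* X_i <- X_j - X_k, truncated at 0 *)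
  | Fetch of nat & nat          (* X_i <- X_(X_j) *)
  | Store of nat & nat          (* X_(X_i) <- X_j *)
  | Jump of nat & nat           (* if X_i > 0 then go to instruction number l *)
  | Read of nat                 (* X_i <- next input bit, or 2 at the end *)
  | Write of nat.               (* append X_i to the output *)

Definition program := seq instr.

Record config := Config {
  pc : nat;
  regs : nat -> nat;
  input : bitseq;
  output : seq nat
}.

Definition set_reg (r : nat -> nat) (i x : nat) : nat -> nat :=
  fun j => if j == i then x else r j.

Definition exec (a : instr) (s : config) : config :=
  let: Config n r inp out := s in
  match a with
  | Const i c => Config n.+1 (set_reg r i c) inp out
  | Add i j k => Config n.+1 (set_reg r i (r j + r k)) inp out
  | Sub i j k => Config n.+1 (set_reg r i (r j - r k)) inp out
  | Fetch i j => Config n.+1 (set_reg r i (r (r j))) inp out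
  | Store i j => Config n.+1 (set_reg r (r i) (r j)) inp out
  | Jump i l => Config (if 0 < r i then l else n.+1) r inp out
  | Read i => if inp is b :: inp'
              then Config n.+1 (set_reg r i (nat_of_bool b)) inp' out
              else Config n.+1 (set_reg r i 2) [::] out
  | Write i => Config n.+1 r inp (rcons out (r i))
  end.

(* The machine halts when the program counter leaves the program. *)
Definition halted (P : program) (s : config) : bool := size P <= pc s.

Definition step (P : program) (s : config) : config :=
  if onth P (pc s) is Some a then exec a s else s.

Definition initial (w : bitseq) : config := Config 0 (fun=> 0) w [::].

Definition halts_within (P : program) (w : bitseq) (t : nat) (out : seq nat)
    : Prop :=
  let s := iter t (step P) (initial w) in halted P s /\ output s = out.

(* A problem relates instances to their correct answers.  It is solvable in
   polynomial time on a class [C] of instances if a single program, on each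
   instance in [C] (nothing is required outside of [C]), outputs a correct
   answer in time polynomial in the length of the encoded instance. *)
Definition poly_time_solvable (I A : Type)
    (enc_in : I -> bitseq) (enc_out : A -> seq nat)
    (C : I -> Prop) (problem : I -> A -> Prop) : Prop :=
  exists (P : program) (c d : nat), forall x : I, C x ->
    exists2 a : A, problem x a &
      halts_within P (enc_in x) (c * size (enc_in x) ^ d + c) (enc_out a).

(* The number of vertices in unary, followed by the rows of the adjacency
   matrix. *)
Definition encode_graph (G : graph) : bitseq :=
  nseq (order G) true ++ false ::
  [seq adj u v | u <- enum (vertex G), v <- enum (vertex G)].

Definition encode_answer (a : option nat) : seq nat :=
  if a is Some k then [:: k] else [::].

(* Main.v *)
Require Import Defs.
From mathcomp Require Import all_boot zify.

(** Let [v] be a centre of the bipartite graph.  Every vertex is within distance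
    2 of [v], so the side opposite to [v] is the neighbourhood of [v].  View a
    cut as a colouring in which [v] is red; it is a matching cut when each vertex
    has at most one neighbour of the other colour, and both colours occur.

    At most one neighbour of [v] is blue.  If there is none, a blue vertex has
    only red neighbours, hence has degree 1; each neighbour of [v] can be given
    one blue pendant neighbour, and the best cut does this wherever possible.  If
    [u] is the blue neighbour of [v], then all other neighbours of [u] are forced
    to be blue.  This determines the colouring up to the pendant vertices, which
    again contribute an edge at each red neighbour of [v] that sees no forced
    vertex.  So, given [v] and [u], feasibility and the largest number of edges
    are described by quantifiers and counting over vertices ([admissible],
    [gain]); [gain_attained] and [matching_cut_gain] show that the maximum over
    all pairs is the maximum size of a matching cut.

    To run this on the machine, quantification, counting and maximum are all
    expressed by sums over the vertices in a small language of arithmetic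
    expressions.  Sums are compiled to loops; as each runs at most as often as
    the graph has vertices, an expression takes polynomial time ([poly_time]).
    The program reads the graph into memory, evaluates the expression [Best] and
    writes its value if it is positive; a value of 0 means that there is no
    matching cut, because the graph is connected. *)

Set Implicit Arguments.
Unset Strict Implicit.
Unset Printing Implicit Defensive.

(** * Matching cuts around a centre *)

Section Cuts.
Variable G : graph.
Implicit Types (x y z v u w : vertex G) (A B : {set vertex G}).

(** A cut is given by its blue side [B], the other vertices being red. *)
Definition sparse_cut B := forall x y z, adj x y -> adj x z ->
  (y \in B) != (x \in B) -> (z \in B) != (x \in B) -> y = z.

(** The red vertices with a blue neighbour.  In a matching cut they correspond to
    the edges, and unlike the edges they are single vertices. *)
Definition border B :=
  [set x | (x \notin B) && [exists y, (y \in B) && adj x y]].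

Lemma cut_edgesC A B : cut_edges A B = cut_edges B A.
Proof.
have sub (C D : {set vertex G}) : cut_edges C D \subset cut_edges D C.
  apply/subsetP => e /imset2P[x y xC]; rewrite inE => /andP[yD xy] ->.
  by apply/imset2P; exists y x; rewrite ?inE ?xC 1?adj_sym 1?setUC.
by apply/eqP; rewrite eqEsubset !sub.
Qed.

Lemma mem_cut_edges B x y : adj x y -> (y \in B) != (x \in B) ->
  [set x; y] \in cut_edges (~: B) B.
Proof.
move=> xy; case yB: (y \in B); case xB: (x \in B) => // _.
  by apply/imset2P; exists x y; rewrite ?inE ?xB ?yB.
by rewrite setUC; apply/imset2P; exists y x; rewrite ?inE ?xB ?yB // adj_sym.
Qed.

Lemma cut_edgesP B e : e \in cut_edges (~: B) B ->
  exists x y, [/\ x \notin B, y \in B, adj x y & e = [set x; y]].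
Proof.
move=> /imset2P[x y]; rewrite !inE => xB /andP[yB xy] ->.
by exists x, y; split.
Qed.

Lemma matching_cutP B : matching (cut_edges (~: B) B) <-> sparse_cut B.
Proof.
split=> [[_ /trivIsetP dis] x y z xy xz yB zB | sparse]; last first.
  split.
    apply/subsetP => e /cut_edgesP[x [y [_ _ xy ->]]].
    by apply/imsetP; exists (x, y); rewrite ?inE.
  apply/trivIsetP => e e' /cut_edgesP[x [y [xB yB xy ->]]].
  move=> /cut_edgesP[x' [y' [xB' yB' xy' ->]]] neq {e e'}.
  rewrite -setI_eq0; apply/eqP/setP => t; rewrite !inE.
  apply/negP => /andP[/orP[] /eqP-> /orP[] /eqP E].
  - subst x'; move: neq; rewrite (sparse x y y') ?eqxx //.
      by rewrite yB (negPf xB).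
    by rewrite yB' (negPf xB).
  - by rewrite E yB' in xB.
  - by rewrite E (negPf xB') in yB.
  - subst y'; move: neq; rewrite (sparse y x x') ?eqxx // 1?adj_sym //.
      by rewrite yB (negPf xB).
    by rewrite yB (negPf xB').
apply/eqP/negPn/negP => yz.
have := dis _ _ (mem_cut_edges xy yB) (mem_cut_edges xz zB).
have -> : [set x; y] != [set x; z].
  apply: contra yz => /eqP/setP/(_ y); rewrite !inE eqxx orbT => /esym/orP[]//.
  by move=> /eqP yx; rewrite yx eqxx in yB.
move=> /(_ isT); rewrite -setI_eq0 => /eqP/setP/(_ x).
by rewrite !inE eqxx.
Qed.

Lemma card_cut_edges B : sparse_cut B ->
  #|cut_edges (~: B) B| = #|border B|.
Proof.
move=> sparse.
pose mate x := odflt x [pick y | (y \in B) && adj x y].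
have mateP x : x \in border B -> [/\ x \notin B, mate x \in B & adj x (mate x)].
  rewrite inE => /andP[xB /existsP[y yP]]; rewrite /mate.
  by case: pickP => [z /andP[] //|/(_ y)]; rewrite yP.
rewrite -(card_in_imset (f := fun x => [set x; mate x]) (D := mem (border B))).
  apply: eq_card => e; apply/idP/imsetP => [|[x xb ->]]; last first.
    have [xB mB xm] := mateP x xb.
    by apply: mem_cut_edges => //; rewrite mB (negPf xB).
  case/cut_edgesP=> x [y [xB yB xy ->]].
  have xb : x \in border B by rewrite inE xB; apply/existsP; exists y; rewrite yB.
  exists x => //; have [_ mB xm] := mateP x xb.
  by rewrite (sparse x y (mate x)) // ?mB ?yB (negPf xB).
move=> x y /mateP[xB mx _] /mateP[yB my _] /setP/(_ x).
rewrite !inE eqxx => /esym/orP[/eqP //|/eqP E].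
by rewrite E my in xB.
Qed.

Lemma matching_cut_intro B : sparse_cut B -> B != set0 -> ~: B != set0 ->
  matching_cut (cut_edges (~: B) B).
Proof.
move=> /matching_cutP sparse B0 A0; split=> //; exists (~: B), B; split=> //.
by split; [rewrite setUC setUCr | rewrite -setI_eq0 setIC setICr eqxx].
Qed.

(** Swapping the sides if needed, a given vertex is red. *)
Lemma matching_cut_elim (M : {set {set vertex G}}) v : matching_cut M ->
  exists B, [/\ sparse_cut B, v \notin B, B != set0 & #|M| = #|border B|].
Proof.
have colour A B : bipartition A B -> A = ~: B.
  case=> /setP cover; rewrite -setI_eq0 => /eqP/setP dis; apply/setP => x.
  by have := cover x; have := dis x; rewrite !inE; do 2 case: (x \in _).
case=> [matM [A [B [AB A0 B0 defM]]]].
have [vB | vB] := boolP (v \in B); last first.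
  move: matM; rewrite defM (colour _ _ AB) => /matching_cutP sparse.
  by exists B; split=> //; rewrite card_cut_edges.
have defB : B = ~: A by rewrite (colour _ _ AB) setCK.
move: matM; rewrite defM cut_edgesC defB => /matching_cutP sparse.
by exists A; split=> //; [move: vB; rewrite defB inE | rewrite card_cut_edges].
Qed.

(** Radius at most 2, written with quantifiers over vertices only, so that it can
    be tested by an expression. *)
Definition central v :=
  [forall w, (w == v) || [exists x, adj v x && ((x == w) || adj x w)]].

Lemma radius2_central : radius_at_most 2 G -> exists v, central v.
Proof.
case=> v dist_v; exists v; apply/forallP => w.
have [_ [[p /and3P[pth _ /eqP last_p] <-] _]] := dist_v w.
case: p pth last_p => [_ <-|x [|y [|//]]] /=; first by rewrite eqxx.
  rewrite andbT => vx xw _; apply/orP; right; apply/existsP; exists x.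
  by rewrite vx xw eqxx.
rewrite andbT => /andP[vx xy] yw _; apply/orP; right; apply/existsP; exists x.
by rewrite vx -yw xy orbT.
Qed.

(** Distances from [v] are at most 2 and alternate between the sides, so the
    neighbourhood of [v] is exactly the side opposite to [v]. *)
Lemma central_sides v : bipartite G -> central v ->
  (forall x y, adj x y -> adj v y = ~~ adj v x) /\
  (forall w, w != v -> ~~ adj v w -> exists2 x, adj v x & adj x w).
Proof.
case=> A [B [[/setP cover]]] _ indA indB cv.
have sideN x y : adj x y -> (y \in A) = (x \notin A).
  move=> xy; have inB z : z \notin A -> z \in B.
    by move=> /negPf zA; have := cover z; rewrite !inE zA.
  case: (boolP (x \in A)) => xA; case: (boolP (y \in A)) => yA //.
    by case/negP: (indA x y xA yA).
  by case/negP: (indB x y (inB x xA) (inB y yA)).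
have reach w : w != v -> ~~ adj v w -> exists2 x, adj v x & adj x w.
  move=> wv vw; have := forallP cv w; rewrite (negPf wv) => /existsP[x].
  by case/andP=> vx /orP[/eqP xw|xw]; [rewrite -xw vx in vw | exists x].
have adj_v w : adj v w = ((w \in A) != (v \in A)).
  apply/idP/idP => [/sideN->|]; first by case: (v \in A).
  apply: contraR => vw; have [->//|wv] := eqVneq w v.
  by have [x /sideN vx /sideN ->] := reach w wv vw; rewrite vx negbK eqxx.
split=> // x y /sideN; rewrite !adj_v => ->.
by case: (x \in A); case: (v \in A).
Qed.

(** In the definitions below [v] is a red centre and [u] its blue neighbour, with
    [u = v] standing for the case that all neighbours of [v] are red.  A
    neighbour [w] of the red vertex [x] can be blue if it is forced to be, being
    adjacent to [u], or if [x] is its only neighbour. *)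
Definition loose v u x w :=
  [&& adj x w, w != v & adj u w || [forall y, adj w y ==> (y == x)]].

(** The edge [uv], if there is one, and one edge for each red neighbour of [v]
    that can have a blue neighbour. *)
Definition gain v u :=
  (u != v) + #|[set x | [&& x != u, adj v x & [exists w, loose v u x w]]]|.

(** Once [u] is blue, so are its neighbours other than [v], because its one red
    neighbour is [v].  These forced vertices must not have two red neighbours,
    and no red neighbour of [v] may see two of them. *)
Definition extendable v u :=
  [forall w, [forall y, [forall z,
     [&& adj u w, w != v, adj w y, adj w z, y != u & z != u] ==> (y == z)]]] &&
  [forall x, [forall y, [forall z,
     [&& x != u, adj x y, adj x z, adj u y, adj u z, y != v & z != v]
     ==> (y == z)]]].

Definition admissible v u :=
  central v && ((u == v) || adj v u && extendable v u).

Lemma gain_le v u : gain v u <= Defs.order G.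
Proof.
rewrite -[leqRHS]card_ord -cardsT (cardsD1 u) inE.
apply: leq_add; first exact: leq_b1.
by apply/subset_leq_card/subsetP => x; rewrite !inE => /andP[->].
Qed.

(** The blue side consists of [u], the vertices it forces ([F]), and one pendant
    neighbour for each red neighbour of [v] that sees no forced vertex ([D]). *)
Lemma gain_attained v u : bipartite G -> admissible v u -> 0 < gain v u ->
  exists2 M : {set {set vertex G}}, matching_cut M & gain v u <= #|M|.
Proof.
move=> bip /andP[cv adm] gain_gt0.
have [sideN reach] := central_sides bip cv.
have vv : adj v v = false := adj_irrefl v.
pose s := adj v; have {}sideN x y : adj x y -> s y = ~~ s x by exact: sideN.
have su : u != v -> s u by case/orP: adm => [->|/andP[]].
pose F w := [&& u != v, w != v & adj u w].
pose forced x := [exists w, adj x w && F w].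
pose leaf x := [pick w | [&& adj x w, w != v & [forall y, adj w y ==> (y == x)]]].
pose D x w := [&& s x, x != u, ~~ forced x & leaf x == Some w].
pose B := [set w | [|| (w == u) && (u != v), F w | [exists x, D x w]]].
have FP w : F w -> [/\ u != v, w != v, adj u w & ~~ s w].
  by case/and3P=> uv wv uw; rewrite (sideN u w uw) su.
have DP x w : D x w -> [/\ s x, adj x w, w != v, ~~ s w & forall y, adj w y -> y = x].
  case/and4P=> sx xu _; rewrite /leaf; case: pickP => // w'.
  case/and3P=> xw wv lf /eqP[<-]; split=> //; first by rewrite (sideN x w') ?sx.
  by move=> y wy; apply/eqP; exact: implyP (forallP lf y) wy.
have BP w : w \in B -> s w -> w = u /\ u != v.
  rewrite inE => /or3P[/andP[/eqP]//|/FP[_ _ _ /negPf->]//|/existsP[x /DP[_ _ _]]].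
  by move=> /negPf->.
have vB : v \notin B.
  rewrite inE; apply/negP => /or3P[/andP[/eqP->]|/FP[_]|/existsP[x /DP[_ _]]].
  - by rewrite eqxx.
  - by rewrite eqxx.
  - by rewrite eqxx.
have uB : u != v -> u \in B by move=> uv; rewrite inE eqxx uv.
have [cond1 cond2] :
   (forall w y z, F w -> adj w y -> adj w z -> y != u -> z != u -> y = z) /\
   (forall x y z, x != u -> adj x y -> adj x z -> F y -> F z -> y = z).
  split.
    move=> w y z /FP[uv wv uw _] wy wz yu zu; apply/eqP.
    move: adm; rewrite (negPf uv).
    move=> /and3P[_ /forallP/(_ w)/forallP/(_ y)/forallP/(_ z) + _].
    by rewrite uw wv wy wz yu zu.
  move=> x y z xu xy xz /FP[uv yv uy _] /FP[_ zv uz _]; apply/eqP.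
  move: adm; rewrite (negPf uv).
  move=> /and3P[_ _ /forallP/(_ x)/forallP/(_ y)/forallP/(_ z)].
  by rewrite xu xy xz uy uz yv zv.
have sparse : sparse_cut B.
  move=> a y z ay az; case aB: (a \in B).
    rewrite !eqb_id => yB zB.
    move: aB; rewrite inE => /or3P[/andP[/eqP au uv]|Fa|/existsP[x /DP[_ _ _ _ lf]]].
    - have toV t : adj a t -> t \notin B -> t = v.
        rewrite au => ut tB; apply/eqP; apply: contraR tB => tv.
        by rewrite inE /F uv tv ut orbT.
      exact: etrans (toV y ay yB) (esym (toV z az zB)).
    - have [uv _ _ _] := FP _ Fa.
      apply: (cond1 a) => //.
        by apply: contraNneq yB => ->; exact: uB.
      by apply: contraNneq zB => ->; exact: uB.
    - exact: etrans (lf y ay) (esym (lf z az)).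
  rewrite !eqbF_neg !negbK => yB zB.
  have [sa | sa] := boolP (s a); last first.
    have [-> _] : y = u /\ u != v by apply: BP => //; rewrite (sideN a y).
    by have [->] : z = u /\ u != v by apply: BP => //; rewrite (sideN a z).
  have au : a != u.
    apply/eqP => au; move: sa aB; rewrite au.
    by case: (eqVneq u v) => [->|/uB -> //]; rewrite /s vv.
  have notS t : adj a t -> t \in B -> F t \/ D a t.
    move=> at_; have st : ~~ s t by rewrite (sideN a t) ?negbK.
    rewrite inE => /or3P[/andP[/eqP tu /su]||/existsP[x Dx]].
    - by rewrite -tu (negPf st).
    - by left.
    - by right; have [_ _ _ _ /(_ a)->] := DP _ _ Dx; rewrite // adj_sym.
  have excl t t' : adj a t -> F t -> D a t' -> False.
    by move=> at_ Ft /and4P[_ _ /existsP[]]; exists t; rewrite at_ Ft.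
  case: (notS y ay yB) => Hy; case: (notS z az zB) => Hz.
  - exact: (cond2 a).
  - by case: (excl y z).
  - by case: (excl z y).
  - by case/and4P: Hy => _ _ _ /eqP Hy; case/and4P: Hz => _ _ _; rewrite Hy => /eqP[].
have gain_border : gain v u <= #|border B|.
  rewrite (cardsD1 v); apply: leq_add.
    case: (eqVneq u v) => [//|uv]; rewrite inE vB /=.
    by rewrite lt0b; apply/existsP; exists u; rewrite uB //; exact: su.
  apply/subset_leq_card/subsetP => x; rewrite !inE => /and3P[xu sx /existsP[w]].
  case/and3P=> xw wv loose_w; have {}sx : s x by [].
  have -> : x != v by apply: contraTneq sx => ->; rewrite /s vv.
  have : x \notin B by apply: contra xu => xB; have [-> _] := BP x xB sx.
  rewrite inE => -> /=.
  apply/existsP; have [/existsP[t /andP[xt Ft]]|nf] := boolP (forced x).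
    by exists t; rewrite inE Ft orbT.
  case: (pickP [pred w | [&& adj x w, w != v & [forall y, adj w y ==> (y == x)]]]).
    move=> t /= /and3P[xt tv lft]; case lfx: (leaf x) => [t'|]; last first.
      by move: lfx; rewrite /leaf; case: pickP => // /(_ t); rewrite xt tv lft.
    exists t'; have Dt : D x t' by rewrite /D sx xu nf lfx eqxx.
    have [_ -> _ _ _] := DP _ _ Dt; rewrite andbT inE; apply/or3P; constructor 3.
    by apply/existsP; exists x.
  move=> /(_ w) /=; rewrite xw wv /= => lf; rewrite lf orbF in loose_w.
  case/negP: nf; apply/existsP; exists w; rewrite xw /F wv loose_w !andbT.
  apply: contraTneq loose_w => ->.
  by rewrite -/(s w) (sideN x w) ?sx.
exists (cut_edges (~: B) B); last by rewrite card_cut_edges.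
apply: matching_cut_intro => //; last by apply/set0Pn; exists v; rewrite inE.
have /card_gt0P[x] : 0 < #|border B| by exact: leq_trans gain_border.
by rewrite inE => /andP[_ /existsP[y /andP[yB _]]]; apply/set0Pn; exists y.
Qed.

(** Take for [u] the blue neighbour of a red centre [v].  A red vertex on the side
    of [v] other than [v] itself has no blue neighbour: that neighbour would be
    adjacent to [v], hence equal to [u], whose only red neighbour is [v]. *)
Lemma matching_cut_gain v (M : {set {set vertex G}}) : bipartite G -> central v ->
  matching_cut M -> exists2 u, admissible v u & 0 < #|M| <= gain v u.
Proof.
move=> bip cv /(matching_cut_elim v)[B [sparse vB B0 ->]].
have [sideN reach] := central_sides bip cv.
have vv : adj v v = false := adj_irrefl v.
have U1 a y z : adj a y -> adj a z -> a \notin B -> y \in B -> z \in B -> y = z.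
  by move=> ay az aB yB zB; apply: (sparse a); rewrite // ?yB ?zB (negPf aB).
have U2 a y z : adj y a -> adj z a -> a \in B -> y \notin B -> z \notin B -> y = z.
  move=> ay az aB yB zB; apply: (sparse a); rewrite 1?adj_sym //.
    by rewrite aB (negPf yB).
  by rewrite aB (negPf zB).
pose u := odflt v [pick y | adj v y && (y \in B)].
(* Valid also when [u] is [v], where it says that no neighbour is blue. *)
have uP y : adj v y -> y \in B -> [/\ y = u, u != v & u \in B].
  move=> vy yB; rewrite /u; case: pickP => [t /andP[vt tB]|/(_ y)]; last by rewrite vy yB.
  rewrite (U1 v y t) //=; split=> //.
  by apply: contraTneq vt => ->; rewrite vv.
have uE : u != v -> adj v u /\ u \in B.
  by rewrite /u; case: pickP => [t /andP[]|] //=; rewrite eqxx.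
exists u.
  rewrite /admissible cv; case: (eqVneq u v) => //= uv.
  have [vu uB] := uE uv; rewrite vu /=.
  have redN w : adj u w -> w != v -> w \in B /\ ~~ adj v w.
    move=> uw wv; split; last by rewrite (sideN u w uw) vu.
    by apply: contraR wv => wB; apply/eqP/(U2 u) => //; rewrite adj_sym.
  have red x w : adj u w -> w != v -> adj w x -> x != u -> x \notin B.
    move=> uw wv wx; apply: contra => xB; have [_ nvw] := redN w uw wv.
    by case: (uP x) => [||->//] //; rewrite (sideN w x).
  apply/andP; split; apply/forallP => x; apply/forallP => y; apply/forallP => z.
    apply/implyP => /and5P[ux xv xy xz /andP[yu zu]]; apply/eqP.
    have [xB _] := redN x ux xv.
    by apply: (U2 x); rewrite 1?adj_sym // (red _ x).
  apply/implyP => /and5P[xu xy xz uy /and3P[uz yv zv]]; apply/eqP.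
  have [yB _] := redN y uy yv; have [zB _] := redN z uz zv.
  by apply: (U1 x) => //; apply: (red x y); rewrite // adj_sym.
apply/andP; split.
  have inb x y : adj x y -> x \notin B -> y \in B -> 0 < #|border B|.
    move=> xy xB yB; apply/card_gt0P; exists x; rewrite inE xB.
    by apply/existsP; exists y; rewrite yB.
  have /set0Pn[y yB] := B0; have yv : y != v by apply: contraTneq yB => ->.
  have [vy|vy] := boolP (adj v y); first exact: (inb v y).
  have [x vx xy] := reach y yv vy; have [xB|xB] := boolP (x \in B).
    exact: (inb v x).
  exact: (inb x y).
rewrite (cardsD1 v); apply: leq_add.
  case vb: (v \in border B) => //.
  move: vb; rewrite inE => /andP[_ /existsP[y /andP[yB vy]]].
  by have [_ ->] := uP y vy yB.
apply/subset_leq_card/subsetP => a; rewrite !inE.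
case/and3P=> av aB /existsP[y /andP[yB ay]].
have yv : y != v by apply: contraTneq yB => ->.
have [va|va] := boolP (adj v a); last first.
  have vy : adj v y by rewrite (sideN a y).
  by case/eqP: av; apply: (U2 y).
have au : a != u.
  apply/eqP => au; move: aB; rewrite au.
  by case: (eqVneq u v) => [uv|/uE[_ ->]//]; rewrite au uv vv in va.
rewrite au /=; apply/existsP; exists y; rewrite /loose ay yv /=.
apply/orP; have [lf|] := boolP [forall z, adj y z ==> (z == a)]; first by right.
case/forallPn=> z; rewrite negb_imply => /andP[yz za]; left.
have vz : adj v z by rewrite (sideN y z) // (sideN a y) // va.
have [zB|zB] := boolP (z \in B); last first.
  by case/eqP: za; apply: (U2 y) => //; rewrite adj_sym.
by have [<- _ _] := uP z vz zB; rewrite adj_sym.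
Qed.

Definition best_gain :=
  \max_(p : vertex G * vertex G | admissible p.1 p.2) gain p.1 p.2.

Lemma best_gain_attained : 0 < best_gain ->
  exists v u, admissible v u /\ best_gain = gain v u.
Proof.
pose adm (p : vertex G * vertex G) := admissible p.1 p.2.
case: (pickP adm) => [p admp _|none]; last by rewrite /best_gain big_pred0.
have [|[v u] ? ?] := @eq_bigmax_cond _ adm (fun p => gain p.1 p.2).
  by apply/card_gt0P; exists p.
by exists v, u.
Qed.

(** A graph of radius at most 2 is connected, so a matching cut has an edge, and
    the value 0 can report that there is none. *)
Lemma best_gain_correct : bipartite G -> radius_at_most 2 G ->
  maximum_matching_cut G (if 0 < best_gain then Some best_gain else None).
Proof.
move=> bip rad; have [v cv] := radius2_central rad.
have upper (M : {set {set vertex G}}) : matching_cut M -> 0 < #|M| <= best_gain.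
  move=> /(matching_cut_gain bip cv)[u adm /andP[-> le]].
  exact: leq_trans le (leq_bigmax_cond (v, u) adm).
case: posnP => [b0 M /upper|b0]; first by rewrite b0; case: #|M|.
split=> [|M /upper/andP[]//].
have [a [b [adm E]]] := best_gain_attained b0.
have [M matM le] : exists2 M : {set {set vertex G}},
    matching_cut M & best_gain <= #|M|.
  by rewrite E in b0 *; exact: gain_attained.
exists M => //; apply/eqP; rewrite eqn_leq le andbT.
by have /andP[] := upper M matM.
Qed.
End Cuts.

(** * Running code on the machine *)

Lemma set_reg_eq r i x : set_reg r i x i = x.
Proof. by rewrite /set_reg eqxx. Qed.

Lemma set_reg_neq r i x j : j != i -> set_reg r i x j = r j.
Proof. by rewrite /set_reg => /negPf->. Qed.

Definition reach (P : program) (t : nat) (s s' : config) : Prop :=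
  exists2 t', t' <= t & iter t' (step P) s = s'.

Lemma reach0 P s : reach P 0 s s. Proof. by exists 0. Qed.

Lemma reach_leq P t t' s s' : t <= t' -> reach P t s s' -> reach P t' s s'.
Proof. by move=> tt' [u ut <-]; exists u => //; exact: leq_trans tt'. Qed.

Lemma reach_trans P s' t t' s s'' :
  reach P t s s' -> reach P t' s' s'' -> reach P (t + t') s s''.
Proof.
move=> [u ut <-] [u' ut' <-]; exists (u + u'); first exact: leq_add.
by rewrite addnC iterD.
Qed.

Lemma reach_step P a t s s' :
  onth P (pc s) = Some a -> reach P t (exec a s) s' -> reach P t.+1 s s'.
Proof.
move=> Pa [u ut <-]; exists u.+1 => //.
by rewrite iterSr /step Pa.
Qed.

Lemma reach_instr P a q r inp out t s' : onth P q = Some a ->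
  reach P t (exec a (Config q r inp out)) s' ->
  reach P t.+1 (Config q r inp out) s'.
Proof. exact: (@reach_step P a t (Config q r inp out)). Qed.

Lemma reach_halts P w t s : reach P t (initial w) s -> halted P s ->
  halts_within P w t (output s).
Proof.
move=> [u ut <-] hs; rewrite /halts_within -(subnK ut) iterD iter_fix //.
by rewrite /step onth_default.
Qed.

Lemma halts_within_leq P w t t' out :
  t <= t' -> halts_within P w t out -> halts_within P w t' out.
Proof.
by move=> tt' [hs <-]; apply: reach_halts hs; exists t.
Qed.

(** Indices into the program, not a splitting of it, so that a fragment can be
    used without naming the code around it. *)
Definition code_at (P : program) (p : nat) (c : program) : Prop :=
  forall i a, onth c i = Some a -> onth P (p + i) = Some a.

Lemma code_at_cons P p a c :
  code_at P p (a :: c) -> onth P p = Some a /\ code_at P p.+1 c.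
Proof.
move=> Pc; split=> [|i b ci]; first by rewrite -(Pc 0) ?addn0.
by rewrite addSnnS; exact: Pc.
Qed.

Lemma code_at_cat P p c c' :
  code_at P p (c ++ c') -> code_at P p c /\ code_at P (p + size c) c'.
Proof.
move=> Pc; split=> i a ci; last first.
  by rewrite -addnA; apply: Pc; rewrite onth_cat ltnNge leq_addr addKn.
apply: Pc; rewrite onth_cat; case: ltnP => // /onth_default E.
by rewrite E in ci.
Qed.

(** * Arithmetic expressions and their compilation *)

(** [Sum x b a] adds up [a] for [x] running over the numbers below the value of
    the variable [b].  Only a variable may bound a sum: then no loop runs longer
    than the largest variable, and an expression costs polynomial time whatever
    it computes. *)
Inductive expr :=
  | Lit of nat
  | Var of nat
  | Bit of expr
  | Plus of expr & expr
  | Minus of expr & expr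
  | Sum of nat & nat & expr.

Fixpoint eval (bits env : nat -> nat) (e : expr) : nat :=
  match e with
  | Lit c => c
  | Var x => env x
  | Bit a => bits (eval bits env a)
  | Plus a b => eval bits env a + eval bits env b
  | Minus a b => eval bits env a - eval bits env b
  | Sum x b a => \sum_(i < env b) eval bits (set_reg env x i) a
  end.

(** Code that starts at address [p] and leaves the value in register [d], using
    the registers from [d] on as a stack.  The map [rho] places the variables,
    register 1 holds the constant 1, and the input bits start at register
    [base].  A sum keeps its total in [d] and counts its variable down in [d.+1];
    the unconditional jump leads to the test at the end of the loop. *)
Fixpoint compile (base : nat) (rho : nat -> nat) (e : expr) (d p : nat) : program :=
  match e with
  | Lit c => [:: Const d c]
  | Var x => [:: Const d 0; Add d d (rho x)]
  | Bit a => compile base rho a d p ++ [:: Const d.+1 base; Add d d d.+1; Fetch d d]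
  | Plus a b => let c := compile base rho a d p in
      c ++ compile base rho b d.+1 (p + size c) ++ [:: Add d d d.+1]
  | Minus a b => let c := compile base rho a d p in
      c ++ compile base rho b d.+1 (p + size c) ++ [:: Defs.Sub d d d.+1]
  | Sum x b a => let c := compile base (set_reg rho x d.+1) a d.+2 (p + 5) in
      [:: Const d 0; Const d.+1 0; Add d.+1 d.+1 (rho b);
          Jump 1 (p + 6 + size c); Defs.Sub d.+1 d.+1 1]
      ++ c ++ [:: Add d d d.+2; Jump d.+1 (p + 4)]
  end.

(** The height of the register stack that the code occupies. *)
Fixpoint width (e : expr) : nat :=
  match e with
  | Lit _ | Var _ => 1
  | Bit a => (width a).+1
  | Plus a b | Minus a b => maxn (width a) (width b).+1
  | Sum _ _ a => (width a).+2
  end.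

(** A bound on the number of executed instructions when no variable exceeds [N]. *)
Fixpoint time (e : expr) (N : nat) : nat :=
  match e with
  | Lit _ => 1
  | Var _ => 2
  | Bit a => time a N + 3
  | Plus a b | Minus a b => time a N + (time b N + 1)
  | Sum _ _ a => 4 + (N * (time a N + 3) + 1)
  end.

Definition keeps (lo hi : nat) (r r' : nat -> nat) : Prop :=
  forall j, (j < lo) || (hi <= j) -> r' j = r j.

Lemma width_gt0 e : 0 < width e.
Proof. by case: e => //= *; rewrite leq_max orbT. Qed.

Section CompileCorrect.
Variables (base : nat) (bits : nat -> nat) (N : nat) (P : program).
Variables (inp : bitseq) (out : seq nat).

Definition ready rho env d (r : nat -> nat) : Prop :=
  [/\ 1 < d, r 1 = 1 & forall k, r (base + k) = bits k] /\
  (forall x : nat, [/\ rho x < d, r (rho x) = env x & env x <= N]).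

Lemma ready_keeps rho env d d' r r' :
  ready rho env d r -> keeps d base r r' -> d <= d' -> ready rho env d' r'.
Proof.
move=> [[d1 r1 mem] vars] keep dd'; split.
  split=> [||k]; [exact: leq_trans dd' | by rewrite keep ?d1 |].
  by rewrite keep ?mem // leq_addr orbT.
move=> x; have [rd rx xN]:= vars x; split=> //; first exact: leq_trans dd'.
by rewrite keep ?rd.
Qed.

(** The bound on the base keeps the scratch registers of the code clear of the
    input bits. *)
Definition compiles e : Prop := forall rho env d p r,
  code_at P p (compile base rho e d p) -> d + width e <= base ->
  ready rho env d r ->
  exists r', [/\ reach P (time e N) (Config p r inp out)
      (Config (p + size (compile base rho e d p)) r' inp out),
    r' d = eval bits env e & keeps d base r r'].

Let stop q q' r : q = q' -> reach P 0 (Config q r inp out) (Config q' r inp out).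
Proof. by move=> ->; exact: reach0. Qed.

(** Common to both binary operations: the second operand is evaluated above the
    first, whose value therefore survives. *)
Lemma compiles_pair a b rho env d p r : compiles a -> compiles b ->
  let ca := compile base rho a d p in
  let cb := compile base rho b d.+1 (p + size ca) in
  code_at P p (ca ++ cb) -> d + maxn (width a) (width b).+1 <= base ->
  ready rho env d r ->
  exists r', [/\ reach P (time a N + time b N) (Config p r inp out)
      (Config (p + size (ca ++ cb)) r' inp out),
    r' d = eval bits env a, r' d.+1 = eval bits env b & keeps d base r r'].
Proof.
move=> IHa IHb ca cb /code_at_cat[Pa Pb]; rewrite addn_maxr geq_max => /andP[wa wb].
move=> rdy; have [ra [runa vala keepa]] := IHa rho env d p r Pa wa rdy.
have rdya := ready_keeps rdy keepa (leqnSn d).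
have [|rb [runb valb keepb]] := IHb rho env d.+1 _ ra Pb _ rdya.
  by rewrite addSnnS.
exists rb; split=> //; last first.
- by move=> j jd; rewrite keepb ?keepa //; lia.
- by rewrite keepb ?ltnSn.
by rewrite size_cat addnA; exact: reach_trans runb.
Qed.

(** Counting down makes the loop invariant the statement of [loop]: with [k] in
    the counter, the terms still missing from the total are those of index below
    [k], and the last of them is added next. *)
Lemma compiles_sum x b a : compiles a -> compiles (Sum x b a).
Proof.
move=> IHa rho env d p r /= /code_at_cons[P0] /code_at_cons[P1].
move=> /code_at_cons[P2] /code_at_cons[P3] /code_at_cons[P4].
set c := compile _ _ a _ _.
rewrite -(addn4 p) -addnS.
move=> /code_at_cat[Pa /code_at_cons[P5] /code_at_cons[P6 _]] w rdy.
rewrite -addn4 in P4; have {}P6 : onth P (p + 6 + size c) = Some (Jump d.+1 (p + 4)).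
  by rewrite -P6; congr onth; lia.
have [[d1 r1 mem] vars] := rdy.
pose f i := eval bits (set_reg env x i) a.
have loop k : forall r', keeps d base r r' -> r' d.+1 = k -> k <= N ->
  exists r'', [/\ reach P (k * (time a N + 3)).+1
      (Config (p + 6 + size c) r' inp out) (Config (p + 7 + size c) r'' inp out),
    r'' d = r' d + \sum_(i < k) f i & keeps d base r r''].
  elim: k => [|k IHk] r' keep r'k kN.
    exists r'; rewrite big_ord0 addn0; split=> //.
    rewrite mul0n; apply: reach_instr P6 _.
    by rewrite /= r'k; apply: stop; lia.
  have r'1 : r' 1 = 1 by rewrite keep ?d1.
  set r1' := set_reg r' d.+1 k.
  have keep1 : keeps d base r r1'.
    by move=> j jd; rewrite /r1' /set_reg; case: eqVneq => [|_]; [lia | exact: keep].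
  have rdy1 : ready (set_reg rho x d.+1) (set_reg env x k) d.+2 r1'.
    have [mem1 vars1] := ready_keeps rdy keep1 (leqW (leqnSn d)).
    split=> // y; have := vars1 y; rewrite /set_reg.
    case: eqVneq => // _ _; split; [exact: ltnSn | | exact: ltnW].
    by rewrite /r1' /set_reg eqxx.
  have [|r2 [run2 val2 keep2]] := IHa _ _ _ _ _ Pa _ rdy1.
    by rewrite !addSn -!addnS.
  set r3 := set_reg r2 d (r2 d + r2 d.+2).
  have keep3 : keeps d base r r3.
    move=> j jd; rewrite /r3 /set_reg; case: eqVneq => [|_]; first by lia.
    by rewrite keep2 ?keep1 //; lia.
  have [||r4 [run4 val4 keep4]] := IHk r3 keep3; last 1 first.
  - exists r4; split=> //; last first.
      rewrite val4 big_ord_recr /= /r3 /set_reg eqxx val2 keep2; last by lia.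
      by rewrite /r1' /set_reg (_ : (d == d.+1) = false) ?addnA 1?addnAC //; lia.
    rewrite mulSn; have -> : (time a N + 3 + k * (time a N + 3)).+1 =
      (time a N + (k * (time a N + 3)).+2).+2 by lia.
    apply: reach_instr P6 _.
    rewrite /= r'k /=; apply: reach_instr P4 _; rewrite /= r'k r'1 subn1 /= -/r1' -addnS.
    apply: reach_trans run2 _; apply: reach_instr P5 _; rewrite /= -/r3.
    by have -> : (p + 5 + size c).+1 = p + 6 + size c by lia.
  - rewrite /r3 /set_reg (_ : (d.+1 == d) = false); last by lia.
    by rewrite keep2 /r1' /set_reg ?eqxx ?ltnSn.
  - exact: ltnW.
have r_b : r (rho b) = env b by have [] := vars b.
have bN : env b <= N by have [] := vars b.
pose ri := set_reg (set_reg r d 0) d.+1 0.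
have ri_b : ri d.+1 + ri (rho b) = env b.
  have [rhod _ _] := vars b; rewrite /ri set_reg_eq.
  by rewrite !set_reg_neq //; lia.
pose r0 := set_reg ri d.+1 (ri d.+1 + ri (rho b)).
have [|||r' [run val keep]] := loop (env b) r0.
- by move=> j jd; rewrite /r0 /ri !set_reg_neq //; lia.
- by rewrite /r0 /set_reg eqxx.
- by [].
exists r'; split=> //; last first.
  rewrite val /r0 set_reg_neq; last by lia.
  by rewrite /ri set_reg_neq ?set_reg_eq //; lia.
apply: (@reach_leq _ (env b * (time a N + 3)).+1.+4).
  by rewrite -(addn4 _.+1) -addn1 addnC leq_add2l leq_add2r leq_mul2r bN orbT.
apply: reach_instr P0 _; apply: reach_instr P1 _.
apply: reach_instr P2 _; apply: reach_instr P3 _.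
rewrite /= -/ri -/r0 (_ : r0 1 = 1) /=; last first.
  by rewrite /r0 /ri !set_reg_neq //; lia.
have -> : p + (size (c ++ [:: Add d d d.+2; Jump d.+1 (p + 4)])).+4.+1 =
  p + 7 + size c.
  by rewrite size_cat /=; lia.
exact: run.
Qed.

Lemma compile_correct e : compiles e.
Proof.
elim: e => [c|x|a IHa|a IHa b IHb|a IHa b IHb|x b a IHa]; last exact: compiles_sum.
- move=> rho env d p r /= /code_at_cons[P0 _] w rdy.
  eexists; split; first by apply: reach_instr P0 _; apply: stop; lia.
    by rewrite /set_reg eqxx.
  by move=> j Hj; rewrite !set_reg_neq //; lia.
- move=> rho env d p r /= /code_at_cons[P0 /code_at_cons[P1 _]] w [_ vars].
  eexists; split; first by apply: reach_instr P0 _; apply: reach_instr P1 _; apply: stop; lia.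
    have [rhod rx _] := vars x.
    by rewrite !set_reg_eq set_reg_neq //; lia.
  by move=> j Hj; rewrite !set_reg_neq //; lia.
- move=> rho env d p r /= /code_at_cat[Pa /code_at_cons[P0]].
  move=> /code_at_cons[P1 /code_at_cons[P2 _]] w rdy; have wa := width_gt0 a.
  have [|r2 [run val keep]] := IHa rho env d p r Pa _ rdy; first by lia.
  eexists; split.
  + apply: reach_trans run _.
    apply: reach_instr P0 _; apply: reach_instr P1 _; apply: reach_instr P2 _.
    by apply: stop; rewrite size_cat /=; lia.
  + have [[_ _ mem] _] := rdy; rewrite -mem -(keep (base + _)); last by lia.
    rewrite !set_reg_eq set_reg_neq ?set_reg_eq ?val ?[_ + base]addnC; last by lia.
    by rewrite !set_reg_neq ?val //; lia.
  + by move=> j Hj; rewrite !set_reg_neq; [exact: keep | lia..].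
all: move=> rho env d p r /=; rewrite catA => /code_at_cat[Pab] /code_at_cons[P0 _].
all: move=> w rdy; have [r2 [run vala valb keep]] := compiles_pair IHa IHb Pab w rdy.
all: eexists; split;
  [ rewrite addnA; apply: reach_trans run _; apply: reach_instr P0 _;
    by apply: stop; rewrite !size_cat /=; lia
  | by rewrite set_reg_eq vala valb
  | by move=> j Hj; rewrite set_reg_neq; [exact: keep | lia] ].
Qed.

End CompileCorrect.

(** * Testing and counting with expressions *)

Section Formulas.

(* Variable 0 holds the order of the graph and bounds every sum. *)
Local Notation N := 0 (only parsing).
Local Notation K := 1 (only parsing).
Local Notation V := 2 (only parsing).
Local Notation U := 3 (only parsing).
Local Notation X := 4 (only parsing).
Local Notation W := 5 (only parsing).
Local Notation Y := 6 (only parsing).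
Local Notation Z := 7 (only parsing).
Local Notation T := 8 (only parsing).

(** A number counts as true when it is positive. *)
Definition Not a := Minus (Lit 1) a.
Definition Or a b := Plus a b.
Definition And a b := Not (Or (Not a) (Not b)).
Definition Implies a b := Or (Not a) b.
Definition Exists x a := Sum x N a.
Definition Forall x a := Not (Exists x (Not a)).
Definition Count x a := Sum x N (Not (Not a)).
Definition Same x y := Not (Plus (Minus (Var x) (Var y)) (Minus (Var y) (Var x))).
Definition Differ x y := Not (Same x y).
(** Entry [x * n + y] of the adjacency matrix, the product being a sum of [x]
    copies of [n]. *)
Definition Adj x y := Bit (Plus (Sum T x (Var N)) (Var y)).

Definition Central :=
  Forall W (Or (Same W V) (Exists X (And (Adj V X) (Or (Same X W) (Adj X W))))).

Definition Extendable :=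
  And
    (Forall W (Forall Y (Forall Z (Implies
       (And (Adj U W) (And (Differ W V) (And (Adj W Y) (And (Adj W Z)
         (And (Differ Y U) (Differ Z U)))))) (Same Y Z)))))
    (Forall X (Forall Y (Forall Z (Implies
       (And (Differ X U) (And (Adj X Y) (And (Adj X Z) (And (Adj U Y)
         (And (Adj U Z) (And (Differ Y V) (Differ Z V))))))) (Same Y Z))))).

Definition Admissible := And Central (Or (Same U V) (And (Adj V U) Extendable)).

Definition Loose :=
  And (Adj X W) (And (Differ W V)
    (Or (Adj U W) (Forall Y (Implies (Adj W Y) (Same Y X))))).

Definition Gain :=
  Plus (Differ U V) (Count X (And (Differ X U) (And (Adj V X) (Exists W Loose)))).

(** The maximum of numbers at most [n] is the number of [k < n] that one of them
    exceeds. *)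
Definition Best :=
  Count K (Exists V (Exists U (And Admissible (Minus Gain (Var K))))).

Section Semantics.
Variables (G : graph) (bits : nat -> nat).
Local Notation n := (Defs.order G).
Hypothesis bits_adj : forall a b : vertex G, bits (a * n + b) = adj a b.

Definition holds (env : nat -> nat) a := 0 < eval bits env a.

Implicit Types (env : nat -> nat).

Lemma eval_not env a : eval bits env (Not a) = ~~ holds env a.
Proof. by rewrite /= /holds; case: (eval _ _ _). Qed.

Lemma eval_plus env a b :
  eval bits env (Plus a b) = eval bits env a + eval bits env b.
Proof. by []. Qed.

Lemma holds_not env a A : holds env a = A -> holds env (Not a) = ~~ A.
Proof. by move=> <-; rewrite {1}/holds eval_not lt0b. Qed.

Lemma holds_or env a b A B :
  holds env a = A -> holds env b = B -> holds env (Or a b) = A || B.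
Proof. by move=> <- <-; rewrite /holds /= addn_gt0. Qed.

Lemma holds_and env a b A B :
  holds env a = A -> holds env b = B -> holds env (And a b) = A && B.
Proof.
move=> aA bB; rewrite -[A && B]negbK negb_and.
by apply/holds_not/holds_or; apply: holds_not.
Qed.

Lemma holds_implies env a b A B :
  holds env a = A -> holds env b = B -> holds env (Implies a b) = (A ==> B).
Proof. by move=> aA bB; rewrite implybE; apply/holds_or => //; apply: holds_not. Qed.

Lemma holds_exists env i a (A : pred (vertex G)) : env 0 = n ->
  (forall t : vertex G, holds (set_reg env i t) a = A t) ->
  holds env (Exists i a) = [exists t, A t].
Proof.
rewrite /holds /= => -> aA; rewrite lt0n sum_nat_eq0.
rewrite -(negbK [exists t, A t]) negb_exists; congr (~~ _).
by apply: eq_forallb => t; rewrite -aA lt0n negbK.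
Qed.

Lemma holds_forall env i a (A : pred (vertex G)) : env 0 = n ->
  (forall t : vertex G, holds (set_reg env i t) a = A t) ->
  holds env (Forall i a) = [forall t, A t].
Proof.
move=> en aA; rewrite -[RHS]negbK negb_forall.
by apply/holds_not/holds_exists => // t; exact: holds_not.
Qed.

Lemma holds_same env i j (a b : vertex G) : env i = a -> env j = b ->
  holds env (Same i j) = (a == b).
Proof.
move=> ia jb; rewrite /Same -[RHS]negbK; apply: holds_not.
by rewrite /holds /= ia jb addn_gt0 !subn_gt0 -neq_ltn eq_sym.
Qed.

Lemma holds_differ env i j (a b : vertex G) : env i = a -> env j = b ->
  holds env (Differ i j) = (a != b).
Proof. by move=> ia jb; apply/holds_not/holds_same. Qed.

Lemma holds_adj env i j (a b : vertex G) : env 0 = n -> env i = a -> env j = b ->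
  holds env (Adj i j) = adj a b.
Proof.
move=> en ia jb; rewrite /holds /= jb (eq_bigr (fun=> n)) => [|t _].
  by rewrite sum_nat_const card_ord ia bits_adj lt0b.
by rewrite /set_reg.
Qed.

Lemma eval_count env i a (A : pred (vertex G)) : env 0 = n ->
  (forall t : vertex G, holds (set_reg env i t) a = A t) ->
  eval bits env (Count i a) = #|[set t | A t]|.
Proof.
move=> en aA.
rewrite -[LHS]/(\sum_(t < env N) eval bits (set_reg env i t) (Not (Not a))) en.
rewrite -sum1dep_card [RHS]big_mkcond /=.
apply: eq_bigr => t _; rewrite -[LHS]/(eval bits (set_reg env i t) (Not (Not a))).
by rewrite eval_not (holds_not (aA t)) negbK; case: (A t).
Qed.

Ltac decode := repeat first
  [ done
  | apply: holds_and | apply: holds_implies | apply: holds_differ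
  | apply: holds_same | apply: holds_adj
  | apply: holds_exists => [//|?] | apply: holds_forall => [//|?]
  | apply: holds_or ].

Lemma holds_central env (a : vertex G) : env 0 = n -> env V = a ->
  holds env Central = central a.
Proof. by move=> en ev; decode. Qed.

Lemma holds_admissible env (a b : vertex G) : env 0 = n -> env V = a -> env U = b ->
  holds env Admissible = admissible a b.
Proof.
move=> en ev eu; apply: holds_and; first exact: holds_central.
by apply: holds_or; [decode | apply: holds_and]; decode.
Qed.

Lemma eval_gain env (a b : vertex G) : env 0 = n -> env V = a -> env U = b ->
  eval bits env Gain = gain a b.
Proof.
move=> en ev eu; rewrite /Gain eval_plus.
congr (_ + _); first by rewrite eval_not (holds_same eu ev).
by apply: eval_count => // t; decode.
Qed.

Lemma eval_best : eval bits (fun=> n) Best = best_gain G.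
Proof.
transitivity #|[set t : vertex G |
    [exists a : vertex G, exists b, admissible a b && (t < gain a b)]]|.
  apply: eval_count => // t.
  apply: holds_exists => // a; apply: holds_exists => // b.
  apply: holds_and; first exact: holds_admissible.
  pose env := set_reg (set_reg (set_reg (fun=> n) K t) V a) U b.
  by rewrite -subn_gt0 -(@eval_gain env).
have bn : best_gain G <= n by apply/bigmax_leqP => p _; exact: gain_le.
transitivity (\sum_(t < n | t < best_gain G) 1); last first.
  by rewrite (big_ord_narrow bn) /= sum1_card card_ord.
rewrite -sum1dep_card; apply: eq_bigl => t; apply/existsP/idP.
  move=> [a /existsP[b /andP[adm lt]]]; apply: leq_trans lt _.
  exact: (leq_bigmax_cond (a, b) adm).
move=> lt; have [|a [b [adm E]]] := @best_gain_attained G; first by case: best_gain lt.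
by exists a; apply/existsP; exists b; rewrite adm -E.
Qed.
End Semantics.

End Formulas.

(** * The machine program *)

Section Solver.
Variable e : expr.

Definition base := 5 + width e.

(** The order goes to register 0, the matrix to the registers from [base] on.
    Reading a 2, which marks the end of the input, makes [2 - 2] end the second
    loop. *)
Definition reader : program :=
  [:: Const 1 1; Read 2; Add 0 0 2; Jump 2 1;
      Const 3 base; Read 2; Store 3 2; Add 3 3 1; Const 4 2; Defs.Sub 4 4 2; Jump 4 5].

(** All variables are placed in register 0, so the free ones denote the order of
    the graph. *)
Definition evaluator := compile base (fun=> 0) e 5 (size reader).

Definition writer (p : nat) : program :=
  [:: Const 6 1; Defs.Sub 6 6 5; Jump 6 (p + 4); Write 5].

Definition solver : program :=
  reader ++ evaluator ++ writer (size reader + size evaluator).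

Lemma reader_at i : i < size reader -> onth solver i = onth reader i.
Proof. by move=> ilt; rewrite /solver onth_cat ilt. Qed.

Lemma read_order m w r out : r 1 = 1 ->
  exists r', [/\ reach solver (3 * m.+1)
      (Config 1 r (nseq m true ++ false :: w) out) (Config 4 r' w out),
    r' 0 = r 0 + m & r' 1 = 1].
Proof.
elim: m r => [|m IHm] r r1.
  eexists; split.
  - do 3 (apply: reach_instr; first by rewrite reader_at).
    by rewrite /=; exact: reach0.
  - by rewrite /set_reg.
  - by rewrite /set_reg.
pose r' := set_reg (set_reg r 2 1) 0 (r 0 + 1).
have [//|r'' [run val0 val1]] := IHm r'.
exists r''; split=> //; last by rewrite val0 /r' set_reg_eq -addnA add1n.
rewrite mulnS; do 3 (apply: reach_instr; first by rewrite reader_at).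
exact: run.
Qed.

Definition next_bit (s : bitseq) : nat := if s is b :: _ then nat_of_bool b else 2.

Lemma read_entry s a r out : 4 < a -> r 1 = 1 -> r 3 = a ->
  exists r', [/\ reach solver 6 (Config 5 r s out)
      (Config (if s is [::] then 11 else 5) r' (behead s) out),
    [/\ r' 0 = r 0, r' 1 = 1 & r' 3 = a.+1], r' a = next_bit s &
    forall j, 4 < j -> j != a -> r' j = r j].
Proof.
move=> a4 r1 r3.
pose r2 := set_reg r 2 (next_bit s); pose ra := set_reg r2 (r2 3) (r2 2).
pose rb := set_reg ra 3 (ra 3 + ra 1); pose rc := set_reg rb 4 2.
pose rd := set_reg rc 4 (rc 4 - rc 2).
have ra_lo i : i < 5 -> ra i = r2 i.
  by move=> i5; rewrite /ra set_reg_neq // [r2 3]r3; lia.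
exists rd; split.
- apply: (@reach_step _ (Read 2)); first by rewrite reader_at.
  have -> : exec (Read 2) (Config 5 r s out) = Config 6 r2 (behead s) out.
    by rewrite /r2; case: (s).
  do 5 (apply: reach_instr; first by rewrite reader_at).
  rewrite /= -/ra -/rb -/rc -/rd.
  have -> : rd 4 = 2 - next_bit s by rewrite -[LHS]/(2 - ra 2) ra_lo.
  by rewrite subn_gt0; case: (s) => [|[] ?]; exact: reach0.
- split.
  + by rewrite -[LHS]/(ra 0) ra_lo.
  + by rewrite -[LHS]/(ra 1) ra_lo.
  + by rewrite -[LHS]/(ra 3 + ra 1) !ra_lo // -[LHS]/(r 3 + r 1) r1 r3 addn1.
- by rewrite /rd /rc /rb !set_reg_neq /ra ?[r2 3]r3 ?set_reg_eq //; lia.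
- by move=> j j4 ja; rewrite /rd /rc /rb /ra [r2 3]r3 /r2 !(@set_reg_neq _ _ _ j) //; lia.
Qed.

(** In the induction, the registers between 4 and [a] hold the entries that have
    been read already. *)
Lemma read_matrix s a r out : 4 < a -> r 1 = 1 -> r 3 = a ->
  exists r', [/\ reach solver (6 * (size s).+1)
      (Config 5 r s out) (Config 11 r' [::] out),
    forall i, i < size s -> r' (a + i) = nth false s i,
    forall j, 4 < j < a -> r' j = r j, r' 0 = r 0 & r' 1 = 1].
Proof.
elim: s a r => [|b s IHs] a r a4 r1 r3.
  have [r' [run [r'0 r'1 r'3] r'a other]] := read_entry [::] out a4 r1 r3.
  exists r'; split=> //.
  by move=> j /andP[j4 ja]; rewrite other ?ltn_eqF.
have [r' [run [r'0 r'1 r'3] r'a other]] := read_entry (b :: s) out a4 r1 r3.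
have [r'' [run' new old r''0 r''1]] := IHs a.+1 r' (leqW a4) r'1 r'3.
exists r''; split=> //; last by rewrite r''0.
- by rewrite mulnS; exact: reach_trans run'.
- case=> [_|i i_s]; first by rewrite addn0 old ?r'a ?a4 /=.
  by rewrite addnS -addSn new.
- move=> j /andP[j4 ja]; rewrite old ?j4 ?(leq_trans ja) //.
  by rewrite other ?ltn_eqF.
Qed.

Lemma nth_adjacency (G : graph) (a b : vertex G) :
  nth false [seq adj x y | x <- enum (vertex G), y <- enum (vertex G)]
    (a * Defs.order G + b) = adj a b.
Proof.
have row (x : vertex G) : size [seq adj x y | y <- enum (vertex G)] = Defs.order G.
  by rewrite size_map size_enum_ord.
have nth_row (xs : seq (vertex G)) i : i < size xs ->
  nth false [seq adj x y | x <- xs, y <- enum (vertex G)] (i * Defs.order G + b)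
    = adj (nth a xs i) b.
  elim: xs i => [|x xs IHxs] [|i] //= lt; rewrite nth_cat row.
    by rewrite mul0n add0n ltn_ord (nth_map b) ?size_enum_ord // nth_ord_enum.
  by rewrite mulSn -addnA ltnNge leq_addr addKn IHxs.
by rewrite nth_row ?size_enum_ord // nth_ord_enum.
Qed.

Definition solve_time N := 6 * N + time e N + 20.

(** The input bits are existential because an expression may look beyond the
    matrix, where it finds whatever the memory holds. *)
Lemma solver_correct (G : graph) : exists bits : nat -> nat,
  (forall a b : vertex G, bits (a * Defs.order G + b) = adj a b) /\
  let k := eval bits (fun=> Defs.order G) e in
  halts_within solver (encode_graph G) (solve_time (size (encode_graph G)))
    (encode_answer (if 0 < k then Some k else None)).
Proof.
set m := Defs.order G.
pose s := [seq adj x y | x <- enum (vertex G), y <- enum (vertex G)].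
set N := size _.
have sizeN : N = m + (size s).+1 by rewrite /N size_cat size_nseq.
have base_gt : 4 < base by rewrite /base leq_addr.
have [//|r1 [run1 r1_0 r1_1]] := @read_order m s (set_reg (fun=> 0) 1 1) [::].
pose r2 := set_reg r1 3 base.
have [|||r3 [run3 bits3 _ r3_0 r3_1]] := @read_matrix s base r2 [::]; try by [].
exists (fun i => r3 (base + i)); split=> [a b | k].
  rewrite bits3 ?nth_adjacency // size_allpairs !size_enum_ord -/m.
  by have := ltn_ord a; have := ltn_ord b; rewrite -/m; nia.
have whole : code_at solver 0 solver by [].
have := whole; rewrite {2}/solver => /code_at_cat[_ /code_at_cat[]].
rewrite add0n => evaluator_at /code_at_cons[W0 /code_at_cons[W1]].
move=> /code_at_cons[W2 /code_at_cons[W3 _]].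
have size_solver : size solver = size reader + size evaluator + 4.
  by rewrite /solver !size_cat addnA.
have [||r4 [run4 val4 _]] := @compile_correct base (fun i => r3 (base + i)) N
  solver [::] [::] e (fun=> 0) (fun=> m) 5 (size reader) r3 evaluator_at.
- by [].
- split=> // i; split=> //; first by rewrite r3_0 /r2 set_reg_neq // r1_0.
  by rewrite sizeN leq_addr.
move: run4 W0 W1 W2 W3 size_solver; rewrite -/evaluator.
move: (size reader + size evaluator) => q run4 W0 W1 W2 W3 size_solver.
have run : reach solver (6 * N + time e N + 16) (initial (encode_graph G))
    (Config q r4 [::] [::]).
  apply: (@reach_leq _ (3 * m.+1 + (6 * (size s).+1 + time e N).+1).+1).
    by lia.
  apply: reach_instr; first by rewrite reader_at.
  apply: reach_trans run1 _.
  apply: reach_instr; first by rewrite reader_at.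
  by apply: reach_trans run3 _.
pose r5 := set_reg r4 6 1; pose r6 := set_reg r5 6 (r5 6 - r5 5).
have r6_6 : r6 6 = 1 - k by rewrite /k -val4.
have r6_5 : r6 5 = k by rewrite /k -val4.
have finish t s' : reach solver t (exec (Jump 6 (q + 4)) (Config q.+2 r6 [::] [::])) s' ->
    t <= 1 -> halted solver s' ->
    halts_within solver (encode_graph G) (solve_time N) (output s').
  move=> run6 t1; apply: reach_halts; rewrite /solve_time.
  have -> : 6 * N + time e N + 20 = 6 * N + time e N + 16 + 4 by rewrite -[RHS]addnA.
  apply: reach_trans run _; apply: (@reach_leq _ t.+3); first by rewrite !ltnS.
  by apply: reach_instr W0 _; apply: reach_instr W1 _; apply: reach_instr W2 _.
rewrite /= r6_6 in finish.
case: (posnP k) => k0.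
  rewrite k0 /= in finish.
  by apply: (finish _ _ (reach0 _ _)) => //; rewrite /halted size_solver.
rewrite -r6_5; apply: (finish 1 (Config q.+4 r6 [::] [:: r6 5])) => //.
  rewrite (_ : 1 - k = 0) /=; last by apply/eqP; rewrite subn_eq0.
  by apply: reach_instr W3 _; exact: reach0.
by rewrite /halted size_solver /= addn4.
Qed.

End Solver.

(** * Polynomial time *)

Definition poly_bounded (f : nat -> nat) :=
  exists c d, forall N, 0 < N -> f N <= c * N ^ d.

Lemma poly_const c : poly_bounded (fun=> c).
Proof. by exists c, 0 => N _; rewrite muln1. Qed.

Lemma poly_id : poly_bounded id.
Proof. by exists 1, 1 => N _; rewrite mul1n expn1. Qed.

Lemma poly_add f g :
  poly_bounded f -> poly_bounded g -> poly_bounded (fun N => f N + g N).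
Proof.
move=> [c [d fb]] [c' [d' gb]]; exists (c + c'), (d + d') => N N0.
by rewrite mulnDl; apply: leq_add;
  [apply: leq_trans (fb N N0) _ | apply: leq_trans (gb N N0) _];
  rewrite leq_mul2l leq_pexp2l ?orbT // ?leq_addr ?leq_addl.
Qed.

Lemma poly_mul f g :
  poly_bounded f -> poly_bounded g -> poly_bounded (fun N => f N * g N).
Proof.
move=> [c [d fb]] [c' [d' gb]]; exists (c * c'), (d + d') => N N0.
by rewrite expnD mulnACA leq_mul ?fb ?gb.
Qed.

Lemma poly_time e : poly_bounded (time e).
Proof.
elim: e => [c|x|a pa|a pa b pb|a pa b pb|x b a pa] /=; try exact: poly_const.
- exact: poly_add pa (poly_const 3).
- exact: poly_add pa (poly_add pb (poly_const 1)).
- exact: poly_add pa (poly_add pb (poly_const 1)).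
- apply: poly_add (poly_const 4) (poly_add _ (poly_const 1)).
  exact: poly_mul poly_id (poly_add pa (poly_const 3)).
Qed.

Theorem theorem15 :
  poly_time_solvable encode_graph encode_answer
    (fun G : graph => bipartite G /\ radius_at_most 2 G)
    maximum_matching_cut.
Proof.
have [c [d bound]] : poly_bounded (solve_time Best).
  apply: poly_add (poly_const 20); apply: poly_add (poly_time Best).
  exact: poly_mul (poly_const 6) poly_id.
exists (solver Best), c, d => G [bip rad].
exists (if 0 < best_gain G then Some (best_gain G) else None).
  exact: best_gain_correct.
have [bits [bits_adj]] := solver_correct Best G.
rewrite (eval_best bits_adj) => run; apply: halts_within_leq run.
apply: leq_trans (bound _ _) (leq_addr _ _).
by rewrite size_cat /= addnS.
Qed.
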